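(* The following problem can be solved in $O(n^5)$ time: given an OT-graph $G=(S,E)$ for a set $S$ of $n$ points in general position in the plane, compute the CC-closure of $G$.
   Context: General position means no three points are collinear. For distinct points $p,q,r$, write $pqr$ for the statement ''the ordered triple $(p,q,r)$ has counterclockwise orientation'' and $\lnot pqr$ for its negation. Consider the following axioms: Axiom 1 (cyclic symmetry): $pqr\implies qrp$. Axiom 2 (antisymmetry): $pqr\implies \lnot prq$. Axiom 3 (nondegeneracy): either $pqr$ or $prq$; as an implication (Axiom 3'): $\lnot pqr\implies prq$. Axiom 4 (interiority): $tqr\land ptr\land pqt\implies pqr$. Axiom 5 (transitivity): $tsp\land tsq\land tsr\land tpq\land tqr\implies tpr$. Let $G=(S,E)$ be a graph on the point set $S$ in which every edge $(a,b)$ is equipped with the partition of $S\setminus\{a,b\}$ by the line $ab$, i.e. $S\setminus\{a,b\}=S_{ab}^+\cup S_{ab}^-$, where $S_{ab}^+$ (resp. $S_{ab}^-$) contains the points $c\in S$ such that $a,b,c$ has counterclockwise (resp. clockwise) orientation. Let $T(G)$ be the set of triples $abc$ of points of $S$ such that $(a,b)$, $(a,c)$ or $(b,c)$ is an edge of $G$; the orientation of such a triple is given by the partition of the corresponding edge. $G$ is an OT-graph for $S$ if the orientation of every triple of points of $S$ can be derived from $T(G)$ using Axioms 1, 2, 3', 4 and 5. The CC-closure of $G$ is the set of all triples (with orientations) that can be proven from $T(G)$ by applying Axioms 1–5. *)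

(* Defs.v *)
From mathcomp Require Import all_boot all_order all_algebra.
From mathcomp Require Import boolp classical_sets reals.

Set Implicit Arguments.
Unset Strict Implicit.
Unset Printing Implicit Defensive.

Import Order.TTheory GRing.Theory Num.Theory.

(** * Points in the plane *)

Section Plane.
Variable R : realType.
Local Open Scope ring_scope.

Definition collinear (p q r : R * R) : Prop :=
  exists a b c : R, ((a != 0) || (b != 0)) /\
    forall x : R * R, x \in [:: p; q; r] -> a * x.1 + b * x.2 = c.

(* Twice the signed area of the triangle pqr. *)
Definition orient_det (p q r : R * R) : R :=
  (q.1 - p.1) * (r.2 - p.2) - (q.2 - p.2) * (r.1 - p.1).

Definition counterclockwise (p q r : R * R) : bool := 0 < orient_det p q r.
Definition clockwise (p q r : R * R) : bool := orient_det p q r < 0.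

Definition general_position n (S : 'I_n -> R * R) : Prop :=
  forall a b c : 'I_n, uniq [:: a; b; c] -> ~ collinear (S a) (S b) (S c).

End Plane.

(** * Graphs with partitions, and derivations *)

(* The point set is labelled by 'I_n.  [splus G a b] and [sminus G a b] are
   meaningful only when (a, b) is an edge. *)
Record pgraph n := PGraph {
  edge : rel 'I_n;
  splus : 'I_n -> 'I_n -> {set 'I_n};
  sminus : 'I_n -> 'I_n -> {set 'I_n}
}.

Definition graph_on (R : realType) n (S : 'I_n -> R * R) (E : rel 'I_n) :
    pgraph n :=
  {| edge := E;
     splus := fun a b =>
       [set c | (c \notin [:: a; b]) && counterclockwise (S a) (S b) (S c)];
     sminus := fun a b =>
       [set c | (c \notin [:: a; b]) && clockwise (S a) (S b) (S c)] |}.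

(* [Pos p q r] is the formal statement pqr and [Neg p q r] its negation. *)
Inductive literal n :=
  | Pos of 'I_n & 'I_n & 'I_n
  | Neg of 'I_n & 'I_n & 'I_n.

(* Only one order of the points of a triple is listed for each orientation of
   an edge; the other orders follow by the first three axioms. *)
Inductive triples_of n (G : pgraph n) : literal n -> Prop :=
  | triples_pos a b c :
      edge G a b -> c \in splus G a b -> triples_of G (Pos a b c)
  | triples_neg a b c :
      edge G a b -> c \in sminus G a b -> triples_of G (Neg a b c).

(* Every axiom is an inference rule from premises to conclusion; nondegeneracy
   is used in its implicational form. *)
Inductive derives n (T : literal n -> Prop) : literal n -> Prop :=
  | derives_hyp l : T l -> derives T l
  | cyclic_symmetry p q r : uniq [:: p; q; r] ->
      derives T (Pos p q r) -> derives T (Pos q r p)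
  | antisymmetry p q r : uniq [:: p; q; r] ->
      derives T (Pos p q r) -> derives T (Neg p r q)
  | nondegeneracy p q r : uniq [:: p; q; r] ->
      derives T (Neg p q r) -> derives T (Pos p r q)
  | interiority p q r t : uniq [:: p; q; r; t] ->
      derives T (Pos t q r) -> derives T (Pos p t r) ->
      derives T (Pos p q t) -> derives T (Pos p q r)
  | transitivity p q r s t : uniq [:: p; q; r; s; t] ->
      derives T (Pos t s p) -> derives T (Pos t s q) ->
      derives T (Pos t s r) -> derives T (Pos t p q) ->
      derives T (Pos t q r) -> derives T (Pos t p r).

Definition orientation (R : realType) n (S : 'I_n -> R * R) (a b c : 'I_n) :
    literal n :=
  if counterclockwise (S a) (S b) (S c) then Pos a b c else Neg a b c.

Definition OT_graph (R : realType) n (S : 'I_n -> R * R) (E : rel 'I_n) : Prop :=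
  forall a b c : 'I_n, uniq [:: a; b; c] ->
    derives (triples_of (graph_on S E)) (orientation S a b c).

(* An oriented triple is an ordered triple listed in counterclockwise order:
   (a, b, c) and (a, c, b) are the two orientations of the same three points. *)
Definition CC_closure n (G : pgraph n) : set ('I_n * 'I_n * 'I_n) :=
  [set x | derives (triples_of G) (Pos x.1.1 x.1.2 x.2)]%classic.

(** * Word RAM *)

(* Structured programs for a random access machine with registers and an
   addressable memory, both indexed by nat. *)
Inductive binop := Add | Sub | Mul.

Definition eval_binop (o : binop) : nat -> nat -> nat :=
  match o with Add => addn | Sub => subn | Mul => muln end.

Inductive prog :=
  | Skip
  | Const (x k : nat)                (* x := k *)
  | Op (o : binop) (x y z : nat)     (* x := y o z *)
  | Read (x y : nat)                 (* x := M[y] *)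
  | Write (x y : nat)                (* M[x] := y *)
  | Seq (P Q : prog)
  | IfLt (x y : nat) (P Q : prog)    (* if x < y then P else Q *)
  | WhileLt (x y : nat) (P : prog).  (* while x < y do P *)

Record state := State { regs : nat -> nat; mem : nat -> nat }.

Definition set_reg (s : state) (x v : nat) : state :=
  State [eta regs s with x |-> v] (mem s).

Definition set_mem (s : state) (i v : nat) : state :=
  State (regs s) [eta mem s with i |-> v].

(* [exec W P s s' t]: started in s, P halts in s' after t steps, each primitive
   instruction and each test counting for one step.  Machine words range over
   [0, W): an instruction whose result is not below W has no execution.  The
   relation is deterministic. *)
Inductive exec (W : nat) : prog -> state -> state -> nat -> Prop :=
  | exec_skip s : exec W Skip s s 1
  | exec_const x k s : k < W ->
      exec W (Const x k) s (set_reg s x k) 1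
  | exec_op o x y z s : eval_binop o (regs s y) (regs s z) < W ->
      exec W (Op o x y z) s
        (set_reg s x (eval_binop o (regs s y) (regs s z))) 1
  | exec_read x y s :
      exec W (Read x y) s (set_reg s x (mem s (regs s y))) 1
  | exec_write x y s :
      exec W (Write x y) s (set_mem s (regs s x) (regs s y)) 1
  | exec_seq P Q s s' s'' t t' :
      exec W P s s' t -> exec W Q s' s'' t' ->
      exec W (Seq P Q) s s'' (t + t')
  | exec_if_true x y P Q s s' t : regs s x < regs s y ->
      exec W P s s' t -> exec W (IfLt x y P Q) s s' t.+1
  | exec_if_false x y P Q s s' t : regs s y <= regs s x ->
      exec W Q s s' t -> exec W (IfLt x y P Q) s s' t.+1
  | exec_while_true x y P s s' s'' t t' : regs s x < regs s y ->
      exec W P s s' t -> exec W (WhileLt x y P) s' s'' t' ->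
      exec W (WhileLt x y P) s s'' (t + t').+1
  | exec_while_false x y P s : regs s y <= regs s x ->
      exec W (WhileLt x y P) s s 1.

(** * Input and output format *)

Definition triple_index (n a b c : nat) : nat := a * n ^ 2 + b * n + c.

Definition side_code n (G : pgraph n) (a b c : 'I_n) : nat :=
  if ~~ edge G a b then 0
  else if c \in splus G a b then 1
  else if c \in sminus G a b then 2
  else 0.

(* The number of points in register 0, then in memory the adjacency matrix
   followed by the partitions of the edges; everything else is 0.  The machine
   has no access to coordinates of points. *)
Definition encodes n (G : pgraph n) (s : state) : Prop :=
  [/\ regs s 0 = n,
      forall x : nat, x != 0 -> regs s x = 0,
      forall a b : 'I_n, mem s (a * n + b) = edge G a b,
      forall a b c : 'I_n,
        mem s (n ^ 2 + triple_index n a b c) = side_code G a b c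
    & forall i : nat, n ^ 2 + n ^ 3 <= i -> mem s i = 0].

(* The characteristic table of a set of oriented triples, from address 0. *)
Definition outputs n (X : set ('I_n * 'I_n * 'I_n)) (s : state) : Prop :=
  forall a b c : 'I_n,
    mem s (triple_index n a b c) = `[< X (a, b, c) >].

Definition bigO_pow (T : nat -> nat) (d : nat) : Prop :=
  exists C n0 : nat, forall n : nat, n0 <= n -> T n <= C * n ^ d.

(* Main.v *)
(* The axioms other than antisymmetry and nondegeneracy, which only swap pqr
   with the negation of prq, are Horn rules on at most five points.  Chaining
   forward with a queue handles each of the at most n^3 oriented triples once:
   it is matched against every premise of every rule, which leaves at most two
   points free, so a triple costs O(n^2) and the whole computation O(n^5).  A
   rule fires when the last of its premises leaves the queue. *)

Require Import Defs.
From mathcomp Require Import all_boot all_order all_algebra.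
From mathcomp Require Import boolp classical_sets reals.
From mathcomp Require Import zify.

Set Implicit Arguments.
Unset Strict Implicit.
Unset Printing Implicit Defensive.

(** The list of discovered triples grows while a triple is being matched, and the property that
    every rule with premises in the list has its conclusion there can be lost when the list grows.
    One pass is therefore specified against the snapshot [Q0] taken at its start: premises are
    required in [Q0], conclusions in the current list, and this property survives growth. It is
    enough, because the invariant of the main loop concerns only premises among the triples already
    dequeued, all of which lie in the snapshot. Soundness travels along the list as an abstract
    predicate [D], later instantiated by derivability, so that the reasoning about the machine never
    mentions derivations. The axioms ask for distinct points, which the program hardly tests:
    derivable triples always have distinct points, and any two points of a rule meet in a common
    premise, with a single exception. *)

Lemma mem_prefix (T : eqType) (s s' : seq T) : prefix s s' -> {subset s <= s'}.
Proof. by case/prefixP=> u -> x xs; rewrite mem_cat xs. Qed.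

(** * Timed execution *)

Section TimedExecution.
Variable W : nat.

Definition wp (P : prog) (t : nat) (post : state -> Prop) (s : state) : Prop :=
  exists s' t', [/\ exec W P s s' t', t' <= t & post s'].

Lemma wp_mono P t t' (post post' : state -> Prop) s : t <= t' ->
  (forall s', post s' -> post' s') -> wp P t post s -> wp P t' post' s.
Proof.
move=> le_t sub [s' [u [? le_u ?]]]; exists s', u.
by split; [|apply: leq_trans le_t|apply: sub].
Qed.

Lemma wp_seq P P' t t' post s :
  wp P t (wp P' t' post) s -> wp (Seq P P') (t + t') post s.
Proof.
move=> [s1 [u [ex1 le1 [s2 [u' [ex2 le2 ?]]]]]]; exists s2, (u + u').
by split=> //; [apply: exec_seq ex1 ex2 | apply: leq_add].
Qed.

(** The index [m] of the invariant is a variant bounding the number of iterations left. Each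
    iteration costs one test besides the body, and the failing test at the end costs the last 1. *)
Lemma wp_while (I : nat -> state -> Prop) x y P t post :
    (forall m s, I m s -> regs s x < regs s y ->
       exists2 m', m = m'.+1 & wp P t (I m') s) ->
    (forall m s, I m s -> regs s y <= regs s x -> post s) ->
  forall m s, I m s -> wp (WhileLt x y P) (m * t.+1 + 1) post s.
Proof.
move=> step stop; elim=> [|m IH] s Is.
  have [lt_xy|le_yx] := ltnP (regs s x) (regs s y).
    by have [] := step _ _ Is lt_xy.
  exists s, 1; split=> //; first exact: exec_while_false.
  exact: stop Is le_yx.
have [lt_xy|le_yx] := ltnP (regs s x) (regs s y).
  have [m' [<-] [s1 [u [ex1 le1 /IH[s2 [u' [ex2 le2 ?]]]]]]] := step _ _ Is lt_xy.
  exists s2, (u + u').+1; split=> //; first exact: exec_while_true ex1 ex2.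
  by rewrite mulSn; lia.
exists s, 1; split; [exact: exec_while_false | by rewrite addn1 |].
exact: stop Is le_yx.
Qed.

(* The weakest precondition for loop-free programs, not the liberal one. *)
Fixpoint wlp (P : prog) (post : state -> Prop) (s : state) : Prop :=
  match P with
  | Skip => post s
  | Const x k => k < W /\ post (set_reg s x k)
  | Op o x y z => eval_binop o (regs s y) (regs s z) < W /\
      post (set_reg s x (eval_binop o (regs s y) (regs s z)))
  | Read x y => post (set_reg s x (Defs.mem s (regs s y)))
  | Write x y => post (Defs.set_mem s (regs s x) (regs s y))
  | Seq P P' => wlp P (wlp P' post) s
  | IfLt x y P P' =>
      if regs s x < regs s y then wlp P post s else wlp P' post s
  | WhileLt _ _ _ => False
  end.

Lemma wlp_seqE P P' post s : wlp (Seq P P') post s = wlp P (wlp P' post) s.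
Proof. by []. Qed.

Lemma wlp_ifE x y P P' post s : wlp (IfLt x y P P') post s =
  if regs s x < regs s y then wlp P post s else wlp P' post s.
Proof. by []. Qed.

(** Summing both branches bounds each of them, so a loop-free program gets a constant read off its
    text, independent of the state. *)
Fixpoint cost (P : prog) : nat :=
  match P with
  | Seq P P' => cost P + cost P'
  | IfLt _ _ P P' => (cost P + cost P').+1
  | _ => 1
  end.

Lemma wlp_mono P (post post' : state -> Prop) s :
  (forall s', post s' -> post' s') -> wlp P post s -> wlp P post' s.
Proof.
elim: P post post' s => [|x k|o x y z|x y|x y|P IH P' IH'|x y P IH P' IH'|//]
  post post' s sub /=; try by move=> ?; apply: sub.
- by case=> ? ?; split=> //; apply: sub.
- by case=> ? ?; split=> //; apply: sub.
- by apply: IH => s'; apply: IH'.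
- by case: ifP => _; [apply: IH | apply: IH'].
Qed.

Lemma wlp_wp P post s : wlp P post s -> wp P (cost P) post s.
Proof.
elim: P post s => [|x k|o x y z|x y|x y|P IH P' IH'|x y P IH P' IH'|//] post s /=.
- by exists s, 1; split=> //; apply: exec_skip.
- by case=> ? ?; exists (set_reg s x k), 1; split=> //; apply: exec_const.
- case=> ? ?; exists (set_reg s x (eval_binop o (regs s y) (regs s z))), 1.
  by split=> //; apply: exec_op.
- move=> ?; exists (set_reg s x (Defs.mem s (regs s y))), 1.
  by split=> //; apply: exec_read.
- move=> ?; exists (Defs.set_mem s (regs s x) (regs s y)), 1.
  by split=> //; apply: exec_write.
- move=> /IH w; apply: wp_seq; apply: wp_mono w => // s'; exact: IH'.
- case: ltnP => [lt_xy /IH|le_yx /IH'] [s' [t [ex le_t ?]]]; exists s', t.+1.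
    by split=> //; [apply: exec_if_true | lia].
  by split=> //; [apply: exec_if_false | lia].
Qed.

End TimedExecution.

(** * The program *)

Local Notation rn := 0 (only parsing).
Local Notation rone := 1 (only parsing).
Local Notation rzero := 2 (only parsing).
Local Notation rsq := 3 (only parsing).
Local Notation rtab := 4 (only parsing).
Local Notation rhead := 6 (only parsing).
Local Notation rtail := 7 (only parsing).
Local Notation ra := 8 (only parsing).
Local Notation rb := 9 (only parsing).
Local Notation rc := 10 (only parsing).
Local Notation rd := 11 (only parsing).
Local Notation re := 12 (only parsing).
Local Notation radr := 13 (only parsing).
Local Notation rval := 14 (only parsing).

Definition block (Ps : seq prog) : prog := foldr Seq Skip Ps.

Definition for_loop (x : nat) (P : prog) : prog :=
  Seq (Const x 0) (WhileLt x rn (Seq P (Op Add x x rone))).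

(** The computed address stays in [radr], where [push] uses it to mark the same table cell. With
    base [rsq] the same code reads the side codes of the input, which start at address n^2. *)
Definition lookup (base : nat) (x : nat * nat * nat) : prog :=
  block [:: Op Mul radr x.1.1 rsq; Op Mul rval x.1.2 rn;
            Op Add radr radr rval; Op Add radr radr x.2;
            Op Add radr radr base; Read rval radr].

Definition push (x : nat * nat * nat) : prog :=
  block [:: Write radr rone; Write rtail x.1.1; Op Add rtail rtail rone;
            Write rtail x.1.2; Op Add rtail rtail rone;
            Write rtail x.2; Op Add rtail rtail rone].

(* Only an instance of transitivity with p = r can have a degenerate conclusion,
   so it is enough to compare the last two points. *)
Definition push_new (x : nat * nat * nat) : prog :=
  Seq (lookup rtab x)
    (IfLt rzero rval Skip
      (IfLt x.1.2 x.2 (push x) (IfLt x.2 x.1.2 (push x) Skip))).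

Fixpoint fire (prems : seq (nat * nat * nat)) (concl : nat * nat * nat) : prog :=
  if prems is x :: prems' then
    Seq (lookup rtab x) (IfLt rzero rval (fire prems' concl) Skip)
  else push_new concl.

(** A code above 1 means clockwise, so the triple enters with its last two points swapped. Several
    edges may orient one triple; [fire] without premises keeps the duplicate test of [push_new]. *)
Definition load_side : prog :=
  Seq (lookup rsq (ra, rb, rc))
    (IfLt rzero rval
      (IfLt rone rval (fire [::] (ra, rc, rb)) (fire [::] (ra, rb, rc)))
      Skip).

(** Polymorphic, so that the same tables serve as program text over register numbers and as rules
    over points. *)
Definition cyc_rule {T} (p q r : T) := ([:: (p, q, r)], (q, r, p)).
Definition int_rule {T} (p q r t : T) :=
  ([:: (t, q, r); (p, t, r); (p, q, t)], (p, q, r)).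
Definition trans_rule {T} (p q r s t : T) :=
  ([:: (t, s, p); (t, s, q); (t, s, r); (t, p, q); (t, q, r)], (t, p, r)).

(* For every premise of every rule, the instance in which that premise is
   (a, b, c) and the remaining points are d and e. *)
Definition rules {T} (a b c d e : T) :=
  [:: cyc_rule a b c; int_rule d b c a; int_rule a d c b; int_rule a b d c;
      trans_rule c d e b a; trans_rule d c e b a; trans_rule d e c b a;
      trans_rule b c d e a; trans_rule d b c e a].

Definition fire_all : prog :=
  block [seq fire x.1 x.2 | x <- rules ra rb rc rd re].

Definition pop : prog :=
  block [:: Read ra rhead; Op Add rhead rhead rone; Read rb rhead;
            Op Add rhead rhead rone; Read rc rhead; Op Add rhead rhead rone].

Definition setup : prog :=
  block [:: Const rone 1; Op Mul rsq rn rn; Op Mul rtab rsq rn;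
            Op Add rhead rtab rtab; Op Add rhead rhead rsq;
            Op Add rtab rtab rsq; Op Add rtail rhead rzero].

Definition copy_cell : prog :=
  block [:: Op Add rval rtab radr; Read rval rval; Write radr rval;
            Op Add radr radr rone].

(** The output overwrites the input. Cell j is read from address n^2 + n^3 + j, which is at least
    n^3 and hence beyond every cell written. *)
Definition copy_table : prog :=
  Seq (block [:: Const radr 0; Op Defs.Sub re rtab rsq]) (WhileLt radr re copy_cell).

(* The table of the triples found so far starts at address n^2 + n^3, and the
   queue, with three cells for each triple, at address n^2 + 2n^3. *)
Definition closure_prog : prog :=
  block [:: setup; for_loop ra (for_loop rb (for_loop rc load_side));
    WhileLt rhead rtail (Seq pop (for_loop rd (for_loop re fire_all)));
    copy_table].

(** * Correctness *)

Section Correctness.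
Variables (W n : nat).
(** There are n^2 + n^3 cells of input, n^3 of table and 3n^3 of queue, so every address, the final
    queue tail included, is at most n^2 + 5n^3. The summand 1 makes room for the constant 1 when n =
    0. *)
Hypothesis W_big : n ^ 2 + 5 * n ^ 3 + 1 < W.
Local Notation triple := ('I_n * 'I_n * 'I_n)%type.
Variables (D : triple -> Prop) (input : nat -> nat).

Definition code (x : triple) : nat := triple_index n x.1.1 x.1.2 x.2.

Lemma triple_index_lt (a b c : 'I_n) : triple_index n a b c < n ^ 3.
Proof.
rewrite /triple_index; have := ltn_ord a; have := ltn_ord b; have := ltn_ord c.
move: (nat_of_ord a) (nat_of_ord b) (nat_of_ord c) => i j k hk hj hi.
have : i.+1 * n ^ 2 <= n * n ^ 2 by rewrite leq_mul2r hi orbT.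
have : j.+1 * n <= n * n by rewrite leq_mul2r hj orbT.
by rewrite !expnS expn0; lia.
Qed.

Lemma code_inj : injective code.
Proof.
move=> [[a b] c] [[a' b'] c']; rewrite /code /triple_index /=.
have := ltn_ord b; have := ltn_ord b'; have := ltn_ord c; have := ltn_ord c'.
move=> hc' hc hb' hb; have n_gt0 : 0 < n by lia.
have e2 x y z : x * n ^ 2 + y * n + z = (x * n + y) * n + z.
  by rewrite mulnDl -mulnA mulnn.
rewrite !e2 => e.
have ec : c = c' :> nat.
  by have := congr1 (modn^~ n) e; rewrite !modnMDl !modn_small.
have /(congr1 (divn^~ n)) : (a * n + b) * n = (a' * n + b') * n by lia.
rewrite /= !mulnK // => e'.
have eb : b = b' :> nat.
  by have := congr1 (modn^~ n) e'; rewrite !modnMDl !modn_small.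
have /(congr1 (divn^~ n)) : a * n = a' * n by lia.
by rewrite /= !mulnK // => ea; congr (_, _, _); apply: val_inj.
Qed.

(* Q lists every triple found so far, in order of discovery; its entries are
   never removed, only the head of the queue advances.  Q0 is the value of Q when
   the current pass of the main loop began. *)
Record core (Q0 Q : seq triple) (s : state) : Prop := Core {
  core_n : regs s rn = n;
  core_one : regs s rone = 1;
  core_zero : regs s rzero = 0;
  core_sq : regs s rsq = n ^ 2;
  core_tab : regs s rtab = n ^ 2 + n ^ 3;
  core_tail : regs s rtail = n ^ 2 + 2 * n ^ 3 + 3 * size Q;
  core_table : forall x, Defs.mem s (n ^ 2 + n ^ 3 + code x) = (x \in Q);
  core_queue : forall x0 i, i < size Q ->
    [/\ Defs.mem s (n ^ 2 + 2 * n ^ 3 + 3 * i) = (nth x0 Q i).1.1,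
        Defs.mem s (n ^ 2 + 2 * n ^ 3 + 3 * i + 1) = (nth x0 Q i).1.2
      & Defs.mem s (n ^ 2 + 2 * n ^ 3 + 3 * i + 2) = (nth x0 Q i).2];
  core_input : forall i, i < n ^ 2 + n ^ 3 -> Defs.mem s i = input i;
  core_sound : forall x, x \in Q -> D x;
  core_uniq : uniq Q;
  core_prefix : prefix Q0 Q
}.

Lemma size_triples (Q : seq triple) : uniq Q -> size Q <= n ^ 3.
Proof.
move=> uQ; have := uniq_leq_size uQ (fun x _ => mem_enum predT x).
by rewrite -cardT !card_prod card_ord expnSr -mulnn.
Qed.

Definition frame (s s' : state) : Prop :=
  forall x, x \notin [:: rtail; radr; rval] -> regs s' x = regs s x.

Lemma core_scratch Q0 Q s x v : x \notin [:: rn; rone; rzero; rsq; rtab; rtail] ->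
  core Q0 Q s -> core Q0 Q (set_reg s x v).
Proof.
rewrite !inE !negb_or => /and5P[? ? ? ? /andP[? ?]] [].
by split=> //=; rewrite eq_sym ifN_eq // eq_sym.
Qed.

(** The numbers 8 to 12 are those of the five point registers, so the range keeps them apart from
    the fixed and the scratch registers. *)
Definition holds (v : nat -> 'I_n) (s : state) (x : nat * nat * nat) : Prop :=
  forall r, r \in [:: x.1.1; x.1.2; x.2] -> 7 < r < 13 /\ regs s r = v r.

Definition ev (v : nat -> 'I_n) (x : nat * nat * nat) : triple :=
  (v x.1.1, v x.1.2, v x.2).

Lemma lookup_wlp Q0 Q base v x post s :
    core Q0 Q s -> holds v s x -> base \in [:: rsq; rtab] ->
    (forall s', core Q0 Q s' -> frame s s' -> Defs.mem s' = Defs.mem s ->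
       regs s' radr = regs s base + code (ev v x) ->
       regs s' rval = Defs.mem s (regs s base + code (ev v x)) -> post s') ->
  wlp W (lookup base x) post s.
Proof.
case: x => [[x y] z] cs hx hbase hpost.
have [/andP[x7 x13] ex] := hx x (mem_head _ _).
have [/andP[y7 y13] ey] : 7 < y < 13 /\ regs s y = v y by apply: hx; rewrite !inE eqxx orbT.
have [/andP[z7 z13] ez] : 7 < z < 13 /\ regs s z = v z by apply: hx; rewrite !inE eqxx !orbT.
have [b13 ble] : base < 13 /\ regs s base <= n ^ 2 + n ^ 3.
  move: hbase; rewrite !inE => /orP[] /eqP->; split=> //.
    by rewrite (core_sq cs) leq_addr.
  by rewrite (core_tab cs).
have lt := triple_index_lt (v x) (v y) (v z); rewrite /triple_index in lt.
have ny r k : r < 13 -> 12 < k -> (r == k) = false by move=> ? ?; apply/eqP; lia.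
rewrite /= !ny //= (core_n cs) (core_sq cs) ex ey ez.
do 5 (split; first by lia).
apply: hpost => //=.
- by do !apply: core_scratch.
- by move=> r; rewrite !inE !negb_or => /and3P[/negPf h1 /negPf h2 /negPf h3] /=; rewrite h2 h3.
- by rewrite addnC.
- by rewrite addnC.
Qed.

Lemma holds_frame v s s' x : frame s s' -> holds v s x -> holds v s' x.
Proof.
move=> fr h r /h[/andP[r7 r13] <-]; split; first by rewrite r7.
by apply: fr; rewrite !inE !negb_or; apply/and3P; split; apply/eqP; lia.
Qed.

Lemma frame_trans s s' s'' : frame s s' -> frame s' s'' -> frame s s''.
Proof. by move=> f g x hx; rewrite g // f. Qed.

Lemma push_wlp Q0 Q v x post s :
    core Q0 Q s -> holds v s x -> regs s radr = n ^ 2 + n ^ 3 + code (ev v x) ->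
    ev v x \notin Q -> D (ev v x) ->
    (forall s', core Q0 (rcons Q (ev v x)) s' -> frame s s' -> post s') ->
  wlp W (push x) post s.
Proof.
case: x => [[x y] z]; set q := ev v _ => cs hx erad qQ Dq hpost.
have [/andP[x7 x13] ex] := hx x (mem_head _ _).
have [/andP[y7 y13] ey] : 7 < y < 13 /\ regs s y = v y by apply: hx; rewrite !inE eqxx orbT.
have [/andP[z7 z13] ez] : 7 < z < 13 /\ regs s z = v z by apply: hx; rewrite !inE eqxx !orbT.
have uQ' : uniq (rcons Q q) by rewrite rcons_uniq qQ (core_uniq cs).
(* Counting the extended list gives a strict bound, hence room for three more queue cells. *)
have szQ : size Q < n ^ 3 by have := size_triples uQ'; rewrite size_rcons.
have n7 r : 7 < r -> (r == 7) = false by move=> ?; apply/eqP; lia.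
rewrite /= !n7 //= (core_one cs) erad (core_tail cs) ex ey ez.
do 3 (split; first by lia).
apply: hpost; last first.
  by move=> r; rewrite !inE !negb_or => /and3P[/negPf h1 /negPf h2 /negPf h3] /=; rewrite h1.
have codeq p : code p < n ^ 3 by apply: triple_index_lt.
have := codeq q; rewrite -/(code q) => cq.
split=> //=; try by case: cs.
- by rewrite size_rcons; lia.
- move=> p; have cp := codeq p; rewrite mem_rcons inE.
  do 3 (case: eqP => [?|_]; first lia).
  by rewrite eqn_add2l (inj_eq code_inj) (core_table cs); case: eqP.
- move=> x0 i; rewrite size_rcons ltnS leq_eqVlt nth_rcons => /predU1P[->|lt_i].
    rewrite ltnn eqxx.
    by split; do ?[case: eqP => [?|?]; try lia].
  rewrite lt_i; have [<- <- <-] := core_queue cs x0 lt_i.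
  by split; do 4 (case: eqP => [?|_]; first lia).
- by move=> i hi; do 4 (case: eqP => [?|_]; first lia); apply: core_input cs _ hi.
- by move=> p; rewrite mem_rcons inE => /predU1P[->|/(core_sound cs)].
- exact: prefix_trans (core_prefix cs) (prefix_rcons _ _).
Qed.

Lemma fire_wlp Q0 Q v prems concl s :
    core Q0 Q s -> (forall x, x \in concl :: prems -> holds v s x) ->
    ((forall x, x \in prems -> ev v x \in Q) ->
     v concl.1.2 != v concl.2 -> D (ev v concl)) ->
  wlp W (fire prems concl) (fun s' => exists Q', [/\ core Q0 Q' s', frame s s',
    prefix Q Q' & (forall x, x \in prems -> ev v x \in Q) ->
      v concl.1.2 != v concl.2 -> ev v concl \in Q']) s.
Proof.
elim: prems s => [|x prems IH] s cs hs sound.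
  have hc : holds v s concl by apply: hs; rewrite mem_head.
  rewrite [fire _ _]/(push_new concl) wlp_seqE.
  apply: (lookup_wlp cs hc) => // s1 cs1 fr1 m1.
  rewrite (core_tab cs) (core_table cs) => e1 e2.
  have [_ ey] : 7 < concl.1.2 < 13 /\ regs s1 concl.1.2 = v concl.1.2.
    by apply: (holds_frame fr1 hc); rewrite !inE eqxx orbT.
  have [_ ez] : 7 < concl.2 < 13 /\ regs s1 concl.2 = v concl.2.
    by apply: (holds_frame fr1 hc); rewrite !inE eqxx !orbT.
  rewrite !wlp_ifE e2 (core_zero cs1) ey ez.
  case: (boolP (ev v concl \in Q)) => [inQ|ninQ] /=.
    by exists Q; split=> //; rewrite prefix_refl.
  have pushed : v concl.1.2 != v concl.2 -> wlp W (push concl)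
      (fun s' => exists Q', [/\ core Q0 Q' s', frame s s',
        prefix Q Q' & (forall x, x \in [::] -> ev v x \in Q) ->
        v concl.1.2 != v concl.2 -> ev v concl \in Q']) s1.
    move=> neq; apply: (push_wlp cs1 (holds_frame fr1 hc) e1 ninQ).
      exact: sound.
    move=> s2 cs2 fr2; exists (rcons Q (ev v concl)); split=> //.
    - exact: frame_trans fr1 fr2.
    - exact: prefix_rcons.
    - by rewrite mem_rcons mem_head.
  case: ltngtP => [lt_yz|lt_zy|eq_yz].
  - by apply: pushed; apply/eqP => e; rewrite e ltnn in lt_yz.
  - by apply: pushed; apply/eqP => e; rewrite e ltnn in lt_zy.
  - exists Q; split; rewrite ?prefix_refl // => _ /eqP[].
    exact: val_inj.
have hx : holds v s x by apply: hs; rewrite !inE eqxx orbT.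
rewrite [fire _ _]/= wlp_seqE.
apply: (lookup_wlp cs hx) => // s1 cs1 fr1 m1.
rewrite (core_tab cs) (core_table cs) => _ e2.
rewrite !wlp_ifE e2 (core_zero cs1).
case: (boolP (ev v x \in Q)) => [inQ|ninQ] /=; last first.
  exists Q; split; rewrite ?prefix_refl // => /(_ x (mem_head _ _)).
  by rewrite (negPf ninQ).
apply: (wlp_mono _ (IH s1 cs1 _ _)).
- move=> s2 [Q' [cs2 fr2 pre impl]]; exists Q'; split=> //.
    exact: frame_trans fr1 fr2.
  by move=> h; apply: impl => y hy; apply: h; rewrite inE hy orbT.
- move=> y hy; apply: (holds_frame fr1); apply: hs.
  by move: hy; rewrite !inE => /orP[->|->]; rewrite ?orbT.
- by move=> h; apply: sound => y; rewrite inE => /predU1P[->|/h].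
Qed.

(** * Specifications of nested loops *)

Definition spec Q0 (E : state -> Prop) P t (R : seq triple -> Prop) : Prop :=
  forall Q s, core Q0 Q s -> E s ->
  wp W P t (fun s' => exists Q', [/\ core Q0 Q' s', E s', prefix Q Q' & R Q']) s.

(** Stability of [R i] under prefix extension lets what one iteration achieves survive the later
    ones. Each iteration adds an increment and a test to the body; the initialisation and the last
    test give the final 2. *)
Lemma spec_for Q0 E x P t (R : 'I_n -> seq triple -> Prop) :
    x \notin [:: rn; rone; rzero; rsq; rtab; rtail] ->
    (forall s v, E s -> E (set_reg s x v)) ->
    (forall i Q Q', prefix Q Q' -> R i Q -> R i Q') ->
    (forall i : 'I_n, spec Q0 (fun s => E s /\ regs s x = i) P t (R i)) ->
  spec Q0 E (for_loop x P) (n * (t + 2) + 2) (fun Q => forall i, R i Q).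
Proof.
move=> hx hE mono body Q s cs Es.
have -> : n * (t + 2) + 2 = 1 + (n * (t + 1).+1 + 1) by rewrite !mulnDr; lia.
apply: wp_seq; apply: (wlp_wp (P := Const x 0)); split; first by lia.
pose I m s' := exists Q', [/\ core Q0 Q' s', E s', prefix Q Q',
  m <= n /\ regs s' x = n - m & forall i : 'I_n, i < n - m -> R i Q'].
apply: (@wp_while W I); last first.
- exists Q; split; rewrite ?prefix_refl ?subnn //=; last by rewrite eqxx.
  - exact: core_scratch.
  - exact: hE.
- move=> m s' [Q' [cs' Es' pre [le_m ex] hR]]; rewrite ex (core_n cs') => le_n.
  by exists Q'; split=> // i; apply: hR; apply: leq_trans le_n.
move=> m s' [Q' [cs' Es' pre [le_m ex] hR]]; rewrite ex (core_n cs') => lt_n.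
exists m.-1; first by lia.
apply: wp_seq; apply: wp_mono (body (Ordinal lt_n) _ _ cs' (conj Es' ex)) => //.
move=> s2 [Q2 [cs2 [Es2 /= ex2] pre2 R2]].
apply: (wlp_wp (P := Op Add x x rone)); rewrite /= (core_one cs2) ex2; split.
  (* The counter goes up to n, and n <= n^2 for positive n keeps it within a word. *)
  have := leq_pexp2l (leq_ltn_trans (leq0n _) lt_n) (isT : 1 <= 2).
  by rewrite expn1; lia.
exists Q2; split.
- exact: core_scratch.
- exact: hE.
- exact: prefix_trans pre pre2.
- by rewrite /= eqxx; lia.
- move=> i lt_i; have [lt_i'|le_i] := ltnP i (n - m).
    exact: mono pre2 (hR _ lt_i').
  by have -> : i = Ordinal lt_n by apply: val_inj => /=; lia.
Qed.

Lemma spec_mono Q0 E P t (R R' : seq triple -> Prop) :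
  (forall Q, R Q -> R' Q) -> spec Q0 E P t R -> spec Q0 E P t R'.
Proof.
move=> sub sp Q s cs Es; apply: wp_mono (sp Q s cs Es) => // s' [Q' [? ? ? ?]].
by exists Q'; split=> //; apply: sub.
Qed.

Lemma spec_fire_block Q0 E v (rs : seq (seq (nat * nat * nat) * (nat * nat * nat))) :
    (forall s s', frame s s' -> E s -> E s') ->
    (forall s r x, E s -> r \in rs -> x \in r.2 :: r.1 -> holds v s x) ->
    (forall r, r \in rs -> (forall x, x \in r.1 -> D (ev v x)) ->
      v r.2.1.2 != v r.2.2 -> D (ev v r.2)) ->
  let P := block [seq fire r.1 r.2 | r <- rs] in
  spec Q0 E P (cost P) (fun Q => forall r, r \in rs ->
    (forall x, x \in r.1 -> ev v x \in Q0) -> v r.2.1.2 != v r.2.2 ->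
    ev v r.2 \in Q).
Proof.
move=> hE; elim: rs => [|r rs IH] hs sound P Q s cs Es.
  apply: (wlp_wp (P := Skip)); exists Q.
  by split; rewrite ?prefix_refl.
apply: wp_seq; have rin : r \in r :: rs := mem_head _ _.
have fr : wlp W _ _ s := fire_wlp cs (fun x => @hs s r x Es rin)
  (fun h => sound r rin (fun x hx => core_sound cs (h x hx))).
apply: wp_mono (wlp_wp fr) => // s1 [Q1 [cs1 fr1 pre1 R1]].
have hs' s' r' x : E s' -> r' \in rs -> x \in r'.2 :: r'.1 -> holds v s' x.
  by move=> Es' hr'; apply: hs Es' _; rewrite inE hr' orbT.
have sound' r' : r' \in rs -> (forall x, x \in r'.1 -> D (ev v x)) ->
    v r'.2.1.2 != v r'.2.2 -> D (ev v r'.2).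
  by move=> hr'; apply: sound; rewrite inE hr' orbT.
apply: wp_mono (IH hs' sound' Q1 s1 cs1 (hE _ _ fr1 Es)) => // s2.
move=> [Q2 [cs2 Es2 pre2 R2]]; exists Q2; split=> //.
  exact: prefix_trans pre1 pre2.
move=> r'; rewrite inE => /predU1P[->|/R2//] inQ0 neq.
apply: (mem_prefix pre2); apply: R1 => // x hx.
exact: mem_prefix (core_prefix cs) _ (inQ0 x hx).
Qed.

(** * Instances of the Horn rules *)

Definition all_rules {T} (p q r s t : T) :=
  [:: cyc_rule p q r; int_rule p q r t; trans_rule p q r s t].

(** This makes it exhaustive to match only the dequeued triple: a rule instance appears in [rules]
    as seen from any one of its premises. *)
Lemma rules_cover (p q r s t : 'I_n) rule x :
  rule \in all_rules p q r s t -> x \in rule.1 ->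
  exists d e, rule \in rules x.1.1 x.1.2 x.2 d e.
Proof.
rewrite !inE => /or3P[] /eqP-> /=; rewrite !inE; last first.
- case/orP=> [|/orP[|/orP[|/orP[]]]] /eqP->.
  + by exists q, r; rewrite !inE eqxx ?orbT.
  + by exists p, r; rewrite !inE eqxx ?orbT.
  + by exists p, q; rewrite !inE eqxx ?orbT.
  + by exists r, s; rewrite !inE eqxx ?orbT.
  + by exists p, s; rewrite !inE eqxx ?orbT.
(* The remaining rules involve at most four points; the spare places are filled with an arbitrary
   point. *)
- case/or3P=> /eqP->.
  + by exists p, p; rewrite !inE eqxx ?orbT.
  + by exists q, q; rewrite !inE eqxx ?orbT.
  + by exists r, r; rewrite !inE eqxx ?orbT.
- by move/eqP->; exists p, p; rewrite !inE eqxx.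
Qed.

Lemma rules_sub (a b c d e : 'I_n) rule : rule \in rules a b c d e ->
  exists p q r s t, rule \in all_rules p q r s t.
Proof.
have cyc p q r : exists p' q' r' s t, cyc_rule p q r \in all_rules p' q' r' s t.
  by exists p, q, r, p, p; rewrite !inE eqxx.
have int p q r t : exists p' q' r' s t', int_rule p q r t \in all_rules p' q' r' s t'.
  by exists p, q, r, p, t; rewrite !inE eqxx orbT.
have trans p q r s t :
    exists p' q' r' s' t', trans_rule p q r s t \in all_rules p' q' r' s' t'.
  by exists p, q, r, s, t; rewrite !inE eqxx !orbT.
by rewrite !inE; do 8 (case/predU1P=> [->//|]); move/eqP->.
Qed.

Hypothesis D_rules : forall (p q r s t : 'I_n) rule,
  rule \in all_rules p q r s t -> (forall x, x \in rule.1 -> D x) ->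
  rule.2.1.2 != rule.2.2 -> D rule.2.

(** * One pass and the main loop *)

Definition at_triple (h : nat) (x : triple) (s : state) : Prop :=
  [/\ regs s rhead = h, regs s ra = x.1.1, regs s rb = x.1.2 & regs s rc = x.2].

Lemma spec_fire_all Q0 h x (d e : 'I_n) :
  spec Q0 (fun s => (at_triple h x s /\ regs s rd = d) /\ regs s re = e)
    fire_all (cost fire_all) (fun Q => forall r,
      r \in rules x.1.1 x.1.2 x.2 d e -> {subset r.1 <= Q0} ->
      r.2.1.2 != r.2.2 -> r.2 \in Q).
Proof.
(* The point registers are consecutive from 8, so [v] sends each of them to its point, and the rules
   over points are by computation the image of the program text. *)
case: x => [[a b] c]; pose v j := nth a [:: a; b; c; d; e] (j - 8).
have rulesE : rules a b c d e =
  [seq (map (ev v) r.1, ev v r.2) | r <- rules ra rb rc rd re] by [].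
apply: spec_mono (spec_fire_block (v := v) _ _ _) => [Q hQ r||s r x|r hr hD neq].
- rewrite rulesE => /mapP[r' hr' ->] /= sub neq; apply: hQ => // x hx.
  by apply: sub; apply: map_f.
- by move=> s s' fr [[[? ? ? ?] ?] ?]; do !split; rewrite fr.
- move=> [[[_ e1 e2 e3] e4] e5] hr hx y hy.
  have : y \in [:: ra; rb; rc; rd; re].
    have : all (fun r => all (fun x : nat * nat * nat =>
        all [in [:: ra; rb; rc; rd; re]] [:: x.1.1; x.1.2; x.2]) (r.2 :: r.1))
      (rules ra rb rc rd re) by [].
    by move=> /allP/(_ r hr)/allP/(_ x hx)/allP/(_ y hy).
  by rewrite !inE => /or4P[||| /orP[]] /eqP->.
- have rin : (map (ev v) r.1, ev v r.2) \in rules a b c d e.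
    by rewrite rulesE; apply/mapP; exists r.
  have [p [q [r' [s [t /D_rules]]]]] := rules_sub rin; apply=> // x.
  by case/mapP=> y /hD Dy ->.
Qed.

(** A pass begins by taking the present list as its snapshot; [core_weaken] forgets the snapshot
    when the pass is over. *)
Lemma core_rebase Q0 Q s : core Q0 Q s -> core Q Q s.
Proof. by case=> *; split; rewrite ?prefix_refl. Qed.

Lemma core_weaken Q0 Q s : core Q0 Q s -> core [::] Q s.
Proof. by case=> *; split; rewrite ?prefix0s. Qed.

Lemma pop_wlp Q s h post : core Q Q s -> h < size Q ->
    regs s rhead = n ^ 2 + 2 * n ^ 3 + 3 * h ->
    (forall s', core Q Q s' -> (forall x0,
      at_triple (n ^ 2 + 2 * n ^ 3 + 3 * h.+1) (nth x0 Q h) s') -> post s') ->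
  wlp W pop post s.
Proof.
move=> cs lt_h eh hpost.
have szQ := size_triples (core_uniq cs).
rewrite /= (core_one cs) eh.
do 3 (split; first by lia); apply: hpost.
  by do !apply: core_scratch.
move=> x0; have [e1 e2 e3] := core_queue cs x0 lt_h.
split=> /=; rewrite ?e1 ?e2 //; first by lia.
by rewrite -addnA e3.
Qed.

(** During the run [F] is the dequeued part of the list [Q]; on exit both are the whole list. *)
Definition closed_on (F Q : seq triple) : Prop := forall p q r s t rule,
  rule \in all_rules p q r s t -> {subset rule.1 <= F} ->
  rule.2.1.2 != rule.2.2 -> rule.2 \in Q.

Definition sweep_cost : nat := n * (n * (cost fire_all + 2) + 2 + 2) + 2.

(** The list has no duplicates, so at most n^3 triples are ever dequeued; [m + h = n^3] turns the
    position [h] of the head into the variant of the loop. *)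
Lemma closure_loop Q s : core [::] Q s ->
    regs s rhead = n ^ 2 + 2 * n ^ 3 ->
  wp W (WhileLt rhead rtail (Seq pop (for_loop rd (for_loop re fire_all))))
    (n ^ 3 * (cost pop + sweep_cost).+1 + 1)
    (fun s' => exists Q', [/\ core [::] Q' s', prefix Q Q' & closed_on Q' Q']) s.
Proof.
move=> cs eh.
pose I m s' := exists Q' h, [/\ core [::] Q' s', prefix Q Q', m + h = n ^ 3,
  h <= size Q' /\ regs s' rhead = n ^ 2 + 2 * n ^ 3 + 3 * h
  & closed_on (take h Q') Q'].
apply: (@wp_while W I); last first.
- exists Q, 0; split; rewrite ?prefix_refl ?addn0 //.
  (* Nothing has been dequeued yet, and every rule has at least one premise. *)
  move=> p q r s1 t rule; rewrite take0 !inE.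
  by case/or3P=> /eqP-> sub; have := sub _ (mem_head _ _).
- move=> m s' [Q' [h [cs' pre _ [le_h ->] cl]]]; rewrite (core_tail cs') => ge_h.
  (* On exit the head has reached the tail, so the dequeued part is the entire list. *)
  by exists Q'; split=> //; rewrite take_oversize in cl => //; lia.
move=> m s' [Q' [h [cs' pre emh [le_h e6] cl]]].
rewrite (core_tail cs') e6 => lt_h.
have {}lt_h : h < size Q' by lia.
have szQ' := size_triples (core_uniq cs').
exists m.-1; first by lia.
have x0 : triple by case: Q' lt_h {cs' pre le_h cl szQ'}.
apply: wp_seq; apply: wlp_wp; apply: (pop_wlp (core_rebase cs') lt_h e6).
move=> s1 cs1 /(_ x0) at1.
set h3 := _ + 3 * h.+1 in at1; set x := nth x0 Q' h in at1.
have sp (d : 'I_n) := spec_for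
  (E := fun s => at_triple h3 x s /\ regs s rd = d) (x := re)
  (R := fun e Q => forall r, r \in rules x.1.1 x.1.2 x.2 d e ->
    {subset r.1 <= Q'} -> r.2.1.2 != r.2.2 -> r.2 \in Q) isT
  (fun s v Es => Es)
  (fun e Q1 Q2 pre12 R1 r hr hF neq => mem_prefix pre12 (R1 r hr hF neq))
  (fun e => @spec_fire_all Q' h3 x d e).
have sp2 := spec_for (E := at_triple h3 x) (x := rd)
  (R := fun d Q => forall e r, r \in rules x.1.1 x.1.2 x.2 d e ->
    {subset r.1 <= Q'} -> r.2.1.2 != r.2.2 -> r.2 \in Q) isT (fun s v Es => Es)
  (fun d Q1 Q2 pre12 R1 e r hr hF neq => mem_prefix pre12 (R1 e r hr hF neq))
  sp.
apply: wp_mono (sp2 _ _ cs1 at1) => // s2 [Q2 [cs2 [e62 _ _ _] pre2 R2]].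
exists Q2, h.+1; split.
- exact: core_weaken cs2.
- exact: prefix_trans pre pre2.
- by lia.
- split=> //; apply: leq_trans lt_h _.
  by case/prefixP: pre2 => u ->; rewrite size_cat leq_addr.
have takeE : take h.+1 Q2 = rcons (take h Q') x.
  by case/prefixP: pre2 => u ->; rewrite takel_cat // -take_nth.
move=> p q r s3 t rule hr; rewrite takeE => sub neq.
(* A rule with premise [x] was tried in this pass; any other one has all its premises among the
   entries dequeued earlier. *)
have [xin|xnin] := boolP (x \in rule.1).
  have [d [e hde]] := rules_cover hr xin.
  apply: (R2 d e rule) => // y /sub; rewrite mem_rcons inE => /predU1P[->|].
    exact: mem_nth.
  exact: mem_take.
apply: (mem_prefix pre2); apply: (cl p q r s3 t rule) => // y hy.
by have := sub y hy; rewrite mem_rcons inE => /predU1P[eyx|//]; rewrite -eyx hy in xnin.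
Qed.

(** * Loading the input and copying the output *)

Definition side (a b c : nat) : nat := input (n ^ 2 + triple_index n a b c).

Hypothesis D_plus : forall a b c : 'I_n, side a b c = 1 -> D (a, b, c).
Hypothesis D_minus : forall a b c : 'I_n, 1 < side a b c -> D (a, c, b).

Definition loaded (a b c : 'I_n) (Q : seq triple) : Prop :=
  (side a b c = 1 -> b != c -> (a, b, c) \in Q) /\
  (1 < side a b c -> c != b -> (a, c, b) \in Q).

Lemma loaded_prefix a b c Q Q' : prefix Q Q' -> loaded a b c Q -> loaded a b c Q'.
Proof.
by move=> /mem_prefix sub [hp hm]; split=> [/hp h /h|/hm h /h]; apply: sub.
Qed.

Lemma spec_load_side h (a b c : 'I_n) :
  spec [::] (fun s => ((regs s rhead = h /\ regs s ra = a) /\ regs s rb = b) /\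
    regs s rc = c) load_side (cost load_side) (loaded a b c).
Proof.
move=> Q s cs Es; have [[[e6 ea] eb] ec] := Es.
pose v j := nth a [:: a; b; c] (j - 8).
have hv x : all [in [:: ra; rb; rc]] [:: x.1.1; x.1.2; x.2] -> holds v s x.
  move=> /allP hx y /hx; rewrite !inE => /or3P[] /eqP->.
  - by rewrite ea.
  - by rewrite eb.
  - by rewrite ec.
apply: wlp_wp; rewrite wlp_seqE.
apply: (lookup_wlp cs (v := v)) => //; first exact: hv.
move=> s1 cs1 fr1 m1 _; have -> : ev v (ra, rb, rc) = (a, b, c) by [].
rewrite (core_sq cs) (core_input cs); last first.
  by have := triple_index_lt a b c; rewrite /code /=; lia.
rewrite -[input _]/(side a b c) => e2.
have at1 s2 : frame s1 s2 -> ((regs s2 rhead = h /\ regs s2 ra = a) /\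
    regs s2 rb = b) /\ regs s2 rc = c.
  by move=> fr2; have fr := frame_trans fr1 fr2; rewrite !fr.
have hv1 x : all [in [:: ra; rb; rc]] [:: x.1.1; x.1.2; x.2] ->
  forall y, y \in [:: x] -> holds v s1 y.
  by move=> hx y; rewrite inE => /eqP->; apply: (holds_frame fr1); apply: hv.
rewrite wlp_ifE (core_zero cs1) e2; case: ltnP => [pos|npos]; last first.
  exists Q; split; rewrite ?prefix_refl //; first exact: at1.
  by split; lia.
rewrite wlp_ifE (core_one cs1) e2; case: ltnP => [gt1|le1].
  have fr := fire_wlp (prems := [::]) cs1 (hv1 (ra, rc, rb) isT).
  apply: wlp_mono (fr _).
    move=> s2 [Q' [cs2 fr2 pre2 R2]]; exists Q'; split=> //; first exact: at1.
    by split=> [|_]; [lia | apply: R2].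
  by move=> _ _; apply: D_minus.
have fr := fire_wlp (prems := [::]) cs1 (hv1 (ra, rb, rc) isT).
apply: wlp_mono (fr _).
  move=> s2 [Q' [cs2 fr2 pre2 R2]]; exists Q'; split=> //; first exact: at1.
  by split=> [_|]; [apply: R2 | lia].
by move=> _ _; apply: (@D_plus a b c); lia.
Qed.

Lemma setup_wlp s : regs s rn = n -> regs s rzero = 0 ->
    (forall i, n ^ 2 + n ^ 3 <= i -> Defs.mem s i = 0) ->
    (forall i, i < n ^ 2 + n ^ 3 -> Defs.mem s i = input i) ->
  wlp W setup (fun s' => core [::] [::] s' /\ regs s' rhead = n ^ 2 + 2 * n ^ 3) s.
Proof.
move=> en e0 mem0 memi; rewrite /= en e0.
have e3 : n * n * n = n ^ 3 by rewrite !expnS expn0 muln1 mulnA.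
rewrite e3 mulnn; do 7 (split; first by lia); split; last by lia.
by split=> //=; try lia; move=> x; rewrite mem0 //; lia.
Qed.

Lemma copy_table_wp Q s : core [::] Q s ->
  wp W copy_table (cost (block [:: Const radr 0; Op Defs.Sub re rtab rsq]) +
      (n ^ 3 * (cost copy_cell).+1 + 1))
    (fun s' => forall x, Defs.mem s' (code x) = (x \in Q)) s.
Proof.
move=> cs; apply: wp_seq; apply: wlp_wp.
rewrite /= (core_sq cs) (core_tab cs).
do 2 (split; first by lia).
pose I m s' := [/\ regs s' rone = 1, regs s' rtab = n ^ 2 + n ^ 3,
  regs s' re = n ^ 3, m <= n ^ 3 /\ regs s' radr = n ^ 3 - m
  & (forall j, j < n ^ 3 - m -> Defs.mem s' j = Defs.mem s (n ^ 2 + n ^ 3 + j)) /\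
    (forall j, n ^ 3 <= j -> Defs.mem s' j = Defs.mem s j)].
apply: (@wp_while W I); last first.
- split=> //=; [exact: core_one cs | exact: core_tab cs | lia | | ].
    by rewrite subnn.
  by rewrite subnn.
- move=> m s' [_ _ -> [_ ->] [tbl _]] le_m x.
  rewrite tbl; first exact: core_table cs x.
  by apply: leq_trans le_m; apply: triple_index_lt.
move=> m s' [e1 e4 e12 [le_m e13] [tbl rest]]; rewrite e12 e13 => lt_m.
exists m.-1; first by lia.
apply: wlp_wp; rewrite /= e1 e4 e13; split; first by lia.
split; first by lia.
split=> //=; first by lia.
split=> j lt_j /=.
  case: eqP => [->|neq]; first by rewrite rest //; lia.
  by apply: tbl; lia.
by case: eqP => [?|_]; [lia | apply: rest].
Qed.

Definition closure_time : nat :=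
  cost setup +
  (n * (n * (n * (cost load_side + 2) + 2 + 2) + 2 + 2) + 2 +
   (n ^ 3 * (cost pop + sweep_cost).+1 + 1 +
    (cost (block [:: Const radr 0; Op Defs.Sub re rtab rsq]) +
      (n ^ 3 * (cost copy_cell).+1 + 1) + 1))).

Lemma closure_prog_wp s : regs s rn = n -> regs s rzero = 0 ->
    (forall i, n ^ 2 + n ^ 3 <= i -> Defs.mem s i = 0) ->
    (forall i, i < n ^ 2 + n ^ 3 -> Defs.mem s i = input i) ->
  wp W closure_prog closure_time (fun s' => exists Q : seq triple,
    [/\ closed_on Q Q, forall a b c, loaded a b c Q, forall x, x \in Q -> D x
      & forall x, Defs.mem s' (code x) = (x \in Q)]) s.
Proof.
move=> en e0 mem0 memi; apply: wp_seq.
apply: wp_mono (wlp_wp (setup_wlp en e0 mem0 memi)) => // s1 [cs1 e6].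
set h := n ^ 2 + 2 * n ^ 3 in e6; apply: wp_seq.
have spc (a b : 'I_n) := spec_for (x := rc)
  (E := fun s => (regs s rhead = h /\ regs s ra = a) /\ regs s rb = b)
  (R := fun c Q => loaded a b c Q) isT (fun s v Es => Es)
  (fun c Q Q' => @loaded_prefix a b c Q Q') (@spec_load_side h a b).
have spb (a : 'I_n) := spec_for (x := rb) (E := fun s => regs s rhead = h /\ regs s ra = a)
  (R := fun b Q => forall c, loaded a b c Q) isT (fun s v Es => Es)
  (fun b Q Q' pre12 R1 c => loaded_prefix pre12 (R1 c)) (spc a).
have spa := spec_for (x := ra) (E := fun s => regs s rhead = h)
  (R := fun a Q => forall b c, loaded a b c Q) isT (fun s v Es => Es)
  (fun a Q Q' pre12 R1 b c => loaded_prefix pre12 (R1 b c)) spb.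
apply: wp_mono (spa _ _ cs1 e6) => // s2 [Q2 [cs2 e62 _ R2]].
apply: wp_seq; apply: wp_mono (closure_loop cs2 e62) => // s3.
move=> [Q3 [cs3 pre3 cl3]].
apply: wp_seq; apply: wp_mono (copy_table_wp cs3) => // s4 tbl.
apply: (wlp_wp (P := Skip)); exists Q3; split=> // [a b c|].
  exact: loaded_prefix pre3 (R2 a b c).
exact: core_sound cs3.
Qed.

End Correctness.

(** * Agreement of the saturated list with derivability *)

Section Closure.
Variables (n : nat) (G : pgraph n).
Hypothesis triples_uniq : forall a b c : 'I_n,
  edge G a b -> c \in splus G a b :|: sminus G a b -> uniq [:: a; b; c].
Hypothesis sides_disjoint : forall a b : 'I_n, [disjoint splus G a b & sminus G a b].

Let T := triples_of G.
Let D (x : 'I_n * 'I_n * 'I_n) : Prop := derives T (Pos x.1.1 x.1.2 x.2).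

Lemma uniq3E (a b c : 'I_n) : uniq [:: a; b; c] = [&& a != b, a != c & b != c].
Proof. by rewrite /= !inE negb_or andbT andbA. Qed.

Lemma derives_uniq l : derives T l ->
  match l with Pos p q r | Neg p q r => uniq [:: p; q; r] end.
Proof.
elim=> {l}.
- by move=> _ [] a b c E Ec; apply: triples_uniq E _; rewrite inE Ec ?orbT.
- by move=> p q r u _ _; rewrite -(rot_uniq 1) in u.
- move=> p q r; rewrite !uniq3E => /and3P[? ? ?] _ _.
  by apply/and3P; split; rewrite // eq_sym.
- move=> p q r; rewrite !uniq3E => /and3P[? ? ?] _ _.
  by apply/and3P; split; rewrite // eq_sym.
- by move=> p q r t u _ _ _ _ _ _; apply: subseq_uniq u; apply: (prefix_subseq [:: p; q; r]).
- move=> p q r s t; rewrite uniq3E /= !inE !negb_or.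
  case/and5P=> /and4P[_ pr _ pt] _ /andP[_ rt] _ _ _ _ _ _ _ _ _ _ _ _.
  by rewrite pr eq_sym pt eq_sym rt.
Qed.

(** The distinctness conditions of the axioms are recovered from the premises: in interiority all
    six pairs of points occur in a common premise, and in transitivity all pairs except p and r.
    This last pair is what the guard on the conclusion supplies. *)
Lemma derives_rules p q r s t rule :
  rule \in all_rules p q r s t -> (forall x, x \in rule.1 -> D x) ->
  rule.2.1.2 != rule.2.2 -> D rule.2.
Proof.
have un a b c : D (a, b, c) -> [/\ a != b, a != c & b != c].
  by move/derives_uniq; rewrite uniq3E => /and3P.
rewrite !inE => /or3P[] /eqP-> /= hD neq.
- have Dpqr : D (p, q, r) by apply: hD; rewrite mem_head.
  exact: (cyclic_symmetry (derives_uniq Dpqr) Dpqr).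
- have D1 : D (t, q, r) by apply: hD; rewrite !inE eqxx ?orbT.
  have D2 : D (p, t, r) by apply: hD; rewrite !inE eqxx ?orbT.
  have D3 : D (p, q, t) by apply: hD; rewrite !inE eqxx ?orbT.
  have [tq tr qr] := un _ _ _ D1; have [pt pr _] := un _ _ _ D2.
  have [pq _ _] := un _ _ _ D3.
  apply: (interiority _ D1 D2 D3).
  by rewrite /= !inE !negb_or pq pr pt qr (eq_sym q) tq (eq_sym r) tr.
have D1 : D (t, s, p) by apply: hD; rewrite !inE eqxx ?orbT.
have D2 : D (t, s, q) by apply: hD; rewrite !inE eqxx ?orbT.
have D3 : D (t, s, r) by apply: hD; rewrite !inE eqxx ?orbT.
have D4 : D (t, p, q) by apply: hD; rewrite !inE eqxx ?orbT.
have D5 : D (t, q, r) by apply: hD; rewrite !inE eqxx ?orbT.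
have [ts tp sp] := un _ _ _ D1; have [_ tq sq] := un _ _ _ D2.
have [_ tr sr] := un _ _ _ D3; have [_ _ pq] := un _ _ _ D4.
have [_ _ qr] := un _ _ _ D5.
apply: (transitivity _ D1 D2 D3 D4 D5); rewrite /= !inE !negb_or pq neq qr /=.
by rewrite -!(eq_sym s) -!(eq_sym t) sp sq sr tp tq tr ts.
Qed.

Lemma closed_complete (input : nat -> nat) Q :
    (forall a b c : 'I_n, side n input a b c = side_code G a b c) ->
    closed_on Q Q -> (forall a b c, loaded input a b c Q) ->
  forall l, derives T l ->
  match l with Pos p q r => (p, q, r) \in Q | Neg p q r => (p, r, q) \in Q end.
Proof.
move=> sideE cl ld l; elim=> {l}.
- move=> _ [] a b c E Ec; have [hp hm] := ld a b c; rewrite sideE /side_code E /= in hp hm.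
    have := triples_uniq E; move=> /(_ c); rewrite inE Ec uniq3E => /(_ isT)/and3P[_ _ neq].
    by rewrite Ec in hp; apply: hp.
  (* [side_code] tests the positive side first, so the code is 2 only because the two sides are
     disjoint. *)
  have := triples_uniq E; move=> /(_ c); rewrite inE Ec orbT uniq3E => /(_ isT)/and3P[_ _ neq].
  rewrite Ec (disjointFl (sides_disjoint a b) Ec) in hm.
  by apply: hm => //; rewrite eq_sym.
- move=> p q r; rewrite uniq3E => /and3P[_ pr _] _ IH.
  have := cl p q r p p (cyc_rule p q r); apply; rewrite ?inE ?eqxx //= 1?eq_sym //.
  by move=> x; rewrite inE => /eqP->.
(* With [Neg p q r] read as the oriented triple (p, r, q), antisymmetry and nondegeneracy each have
   the same premise and conclusion. *)
- by [].
- by [].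
- move=> p q r t u _ IH1 _ IH2 _ IH3.
  have := cl p q r p t (int_rule p q r t); apply; rewrite ?inE ?eqxx ?orbT //=.
    by move=> x; rewrite !inE => /or3P[] /eqP->.
  by move: u; rewrite /= !inE !negb_or => /andP[_ /andP[/andP[]]].
- move=> p q r s t u _ IH1 _ IH2 _ IH3 _ IH4 _ IH5.
  have := cl p q r s t (trans_rule p q r s t); apply; rewrite ?inE ?eqxx ?orbT //=.
    by move=> x; rewrite !inE => /or4P[| | | /orP[]] /eqP->.
  by move: u; rewrite /= !inE !negb_or => /andP[/and4P[]].
Qed.

Lemma closure_prog_correct W s : n ^ 2 + 5 * n ^ 3 + 1 < W -> encodes G s ->
  wp W closure_prog (closure_time n) (outputs (CC_closure G)) s.
Proof.
move=> W_big [en e0 eE eside emem].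
have sideE (a b c : 'I_n) : side n (Defs.mem s) a b c = side_code G a b c by apply: eside.
have plus (a b c : 'I_n) : side n (Defs.mem s) a b c = 1 -> D (a, b, c).
  rewrite sideE /side_code; case: ifP => // /negbFE E; case: ifP => [Ec _|_].
    by apply: derives_hyp; apply: triples_pos.
  by case: ifP.
have minus (a b c : 'I_n) : 1 < side n (Defs.mem s) a b c -> D (a, c, b).
  rewrite sideE /side_code; case: ifP => // /negbFE E; case: ifP => // _.
  case: ifP => // Ec _; have Dabc : derives T (Neg a b c).
    by apply: derives_hyp; apply: triples_neg.
  exact: (nondegeneracy (derives_uniq Dabc) Dabc).
have run := closure_prog_wp W_big derives_rules plus minus en (e0 2 isT) emem
  (fun _ _ => erefl).
apply: wp_mono run => // s' [Q [cl ld sound tbl]] a b c.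
rewrite (tbl (a, b, c)); congr nat_of_bool; apply/idP/asboolP.
  exact: sound.
exact: closed_complete sideE cl ld _.
Qed.

End Closure.

(** * Running time *)

Lemma bigO_pow_const c : bigO_pow (fun=> c) 0.
Proof. by exists c, 0 => n _; rewrite muln1. Qed.

Lemma bigO_pow_weaken f d d' : d <= d' -> bigO_pow f d -> bigO_pow f d'.
Proof.
(* The threshold is raised to keep n positive, since 0 ^ 0 = 1 exceeds the higher powers of 0. *)
move=> le_d [C [n0 hf]]; exists C, n0.+1 => n lt_n.
apply: leq_trans (hf n (ltnW lt_n)) _; rewrite leq_mul2l leq_pexp2l ?orbT //.
exact: leq_trans lt_n.
Qed.

Lemma bigO_pow_add f g d : bigO_pow f d -> bigO_pow g d ->
  bigO_pow (fun n => f n + g n) d.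
Proof.
move=> [C [n0 hf]] [C' [n1 hg]]; exists (C + C'), (maxn n0 n1) => n.
by rewrite geq_max mulnDl => /andP[/hf ? /hg ?]; apply: leq_add.
Qed.

Lemma bigO_pow_mul k f d : bigO_pow f d -> bigO_pow (fun n => n ^ k * f n) (k + d).
Proof.
move=> [C [n0 hf]]; exists C, n0 => n /hf le_f.
by rewrite expnD mulnCA leq_mul2l le_f orbT.
Qed.

Lemma bigO_pow_loop f d : bigO_pow f d ->
  bigO_pow (fun n => n * (f n + 2) + 2) d.+1.
Proof.
move=> hf; have c2 k := bigO_pow_weaken (leq0n k) (bigO_pow_const 2).
apply: bigO_pow_add (c2 _).
have [C [n0 h]] := bigO_pow_mul 1 (bigO_pow_add hf (c2 d)).
by exists C, n0 => n /h.
Qed.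

Lemma closure_time_bigO : bigO_pow closure_time 5.
Proof.
have const c k := bigO_pow_weaken (leq0n k) (bigO_pow_const c).
have loop3 := bigO_pow_loop (bigO_pow_loop (bigO_pow_loop (bigO_pow_const (cost load_side)))).
(* One pass is quadratic, and at most n^3 passes are made. *)
have sweep : bigO_pow (fun n => cost pop + sweep_cost n + 1) 2.
  apply: bigO_pow_add (const 1 2); apply: bigO_pow_add (const _ 2) _.
  exact: bigO_pow_loop (bigO_pow_loop (bigO_pow_const (cost fire_all))).
apply: bigO_pow_add (const _ 5) _; apply: bigO_pow_add.
  exact: bigO_pow_weaken loop3.
apply: bigO_pow_add.
  apply: bigO_pow_add (const _ 5).
  by have [C [n0 h]] := bigO_pow_mul 3 sweep; exists C, n0 => n /h; rewrite addn1.
apply: bigO_pow_add (const _ 5); apply: bigO_pow_add (const _ 5) _.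
exact: bigO_pow_add (bigO_pow_mul 3 (const (cost copy_cell).+1 2)) (const 1 5).
Qed.

(** The base n + 2 is at least 2 even for n = 0, so three of the six factors contribute at least 8,
    which absorbs the constant 5 in front of n^3. *)
Lemma word_size n : n ^ 2 + 5 * n ^ 3 + 1 < (n + 2) ^ 6.
Proof.
have : 8 * (n + 2) ^ 3 <= (n + 2) ^ 3 * (n + 2) ^ 3.
  by rewrite leq_mul2r (leq_exp2r 2 (n + 2) (isT : 0 < 3)) leq_addl orbT.
rewrite -expnD; apply: leq_trans.
by rewrite !expnS !expn0; nia.
Qed.

(* Words of value below (n + 2) ^ k have O(log n) bits. *)
Theorem theorem7 :
  exists (P : prog) (k : nat) (T : nat -> nat),
    bigO_pow T 5 /\
    forall (R : realType) (n : nat) (S : 'I_n -> R * R) (E : rel 'I_n),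
      injective S -> general_position S ->
      symmetric E -> irreflexive E ->
      OT_graph S E ->
      forall s : state, encodes (graph_on S E) s ->
      exists (s' : state) (t : nat),
        [/\ exec ((n + 2) ^ k) P s s' t,
            t <= T n
          & outputs (CC_closure (graph_on S E)) s'].
Proof.
exists closure_prog, 6, closure_time; split; first exact: closure_time_bigO.
move=> R n S E _ _ _ Eirr _ s enc.
apply: (closure_prog_correct _ _ (word_size n) enc) => [a b c Eab|a b].
  rewrite /= in Eab; rewrite uniq3E !inE -andb_orr => /andP[]; rewrite negb_or => /andP[ca cb] _.
  rewrite ![_ == c]eq_sym ca cb !andbT.
  by apply: contraTneq Eab => ->; rewrite Eirr.
rewrite -setI_eq0; apply/eqP/setP=> c; rewrite !inE /counterclockwise /clockwise.
by case: Order.TotalTheory.ltgtP; rewrite ?andbF.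
Qed.
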